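(* Let $P$ be a finite $(\mathbf{3}+\mathbf{1})$-free poset and let $\lambda/\mu/d$ be a cylindric shape. Then $$s_{\lambda/\mu/d}^P(\mathbf{u}) = \sum_{T \in \mathrm{CT}_P(\lambda/\mu/d)} \mathbf{u}^T,$$ where $\mathbf{u}^T=\prod_{b\in\lambda/\mu}u_{T(b)}$.
   Context: A poset is $(\mathbf{3}+\mathbf{1})$-free if it has no induced subposet isomorphic to the disjoint union of a 3-element chain and a single element. Partitions are identified with Young diagrams $\{(i,j):1\le j\le\lambda_i\}$ in matrix (English) coordinates (box $(i,j)$ is in row $i$, column $j$); $\lambda'$ is the transpose of $\lambda$; for $\mu\subset\lambda$, $\lambda/\mu$ is the set of boxes in $\lambda$ not in $\mu$. Parts with index beyond the length of a partition are $0$. $P$-tableaux: for a poset $P$, a function $T:\lambda/\mu\to P$ is a $P$-tableau of shape $\lambda/\mu$ if $T(i,j)<_P T(i+1,j)$ and $T(i,j)\not>_P T(i,j+1)$ whenever both boxes lie in $\lambda/\mu$. Cylindric $P$-tableaux: let $l=\lambda_1$. For $T:\lambda/\mu\to P$ and an integer $d\ge 0$, $T^d$ is the filling obtained by gluing a copy of the first column of $T$ to the right of the last column (column $l$), with the copy shifted up by $d$ cells. That is, $T^d$ has shape $\nu/\theta$ with $\nu'=(\lambda_1'+d,\dots,\lambda_l'+d,\lambda_1')$ and $\theta'=(\mu_1'+d,\dots,\mu_l'+d,\mu_1')$, with $T^d(r,c)=T(r-d,c)$ for $c\le l$ and $T^d(r,l+1)=T(r,1)$. A triple $\lambda/\mu/d$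 with $\mu\subset\lambda$ is a cylindric shape if $\max(\lambda_1'-\lambda'_{\lambda_1},\ \mu_1'-\mu'_{\lambda_1})\le d\le\lambda_1'$. A cylindric $P$-tableau of shape $\lambda/\mu/d$ is a function $T:\lambda/\mu\to P$ such that $T^d$ is a $P$-tableau; $\mathrm{CT}_P(\lambda/\mu/d)$ is the set of these. When $P$ is the total order on $\mathbb{Z}_{>0}$, write $\mathrm{CSSYT}(\lambda/\mu/d)$ for this set. Cylindric Schur functions and $P$-analogs: $s_{\lambda/\mu/d}(\mathbf{x})=\sum_{T\in\mathrm{CSSYT}(\lambda/\mu/d)}\prod_{b\in\lambda/\mu}x_{T(b)}$, which is a symmetric function in $\mathbf{x}=(x_1,x_2,\dots)$. For a finite poset $P$, let $\mathbb{Z}[\mathbf{u}]$ be the polynomial ring in commuting variables $u_p$, $p\in P$, and let $e_k^P(\mathbf{u})=\sum_{i_1<_P\cdots<_P i_k}u_{i_1}\cdots u_{i_k}$ (with $e_0^P=1$ and $e_k^P=0$ for $k<0$). Let $\psi:\Lambda(\mathbf{x})\to\mathbb{Z}[\mathbf{u}]$ be the ring homomorphism from the ring of symmetric functions (over $\mathbb{Z}$) with $\psi(e_k(\mathbf{x}))=e_k^P(\mathbf{u})$. The $P$-cylindric Schur function is $$s^P_{\lambda/\mu/d}(\mathbf{u}):=\psi(s_{\lambda/\mu/d}(\mathbf{x}))=\sum_{\substack{k_1+\cdots+k_{\lambda_1}=0\\ k_i\in\mathbb{Z}}}\det\left[e^P_{k_i(\lambda_1+d)+\lambda_i'-\mu_j'-i+j}(\mathbf{u})\right]_{i,j=1}^{\lambda_1},$$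 the second equality being the known determinantal (Jacobi–Trudi-type) formula for cylindric Schur functions (Gessel–Krattenthaler, Postnikov). *)

(* Defs.v *)
From HB Require Import structures.
From mathcomp Require Import all_boot all_order all_algebra.
From mathcomp Require Import boolp.
From mathcomp Require Import mpoly.

Set Implicit Arguments.
Unset Strict Implicit.
Unset Printing Implicit Defensive.

Import Order.TTheory GRing.Theory.

Local Open Scope ring_scope.

(* Variables are indexed from 0.  [setvars m n] is the ring morphism
   Z[x_0, .., x_{m-1}] -> Z[x_0, .., x_{n-1}] fixing x_i for i < n and sending
   x_i to 0 for i >= n.  *)
Definition xvar (n i : nat) : {mpoly int[n]} :=
  if insub i is Some j then 'X_j else 0.

Definition setvars (m n : nat) (p : {mpoly int[m]}) : {mpoly int[n]} :=
  p \mPo [tuple xvar n i | i < m].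
Arguments setvars : clear implicits.

Definition is_symfun (f : forall n, {mpoly int[n]}) : Prop :=
  [/\ forall n, f n \is symmetric,
      forall n, setvars n.+1 n (f n.+1) = f n
    & exists D, forall n, (msize (f n) <= D)%N].

(* The ring of symmetric functions over Z in x_0, x_1, .., as the graded inverse
   limit of the rings of symmetric polynomials: f is represented by its
   truncations f(x_0, .., x_{n-1}, 0, 0, ..). *)
Record Lambda := Symfun {
  trunc :> forall n, {mpoly int[n]};
  truncP : is_symfun trunc
}.

HB.instance Definition _ := gen_eqMixin Lambda.
HB.instance Definition _ := gen_choiceMixin Lambda.

Lemma Lambda_eq (f g : Lambda) : (forall n, f n = g n) -> f = g.
Proof.
case: f g => [f fP] [g gP] /= fg.
have E : f = g by apply: functional_extensionality_dep.
by subst g; congr Symfun; exact: Prop_irrelevance.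
Qed.

Lemma setvarsD m n : {morph setvars m n : p q / p + q}.
Proof. by move=> p q; rewrite /setvars comp_mpolyD. Qed.
Lemma setvarsM m n : {morph setvars m n : p q / p * q}.
Proof. by move=> p q; rewrite /setvars rmorphM. Qed.
Lemma setvarsN m n : {morph setvars m n : p / - p}.
Proof. by move=> p; rewrite /setvars comp_mpolyN. Qed.

Lemma symfun0 : is_symfun (fun=> 0).
Proof.
split=> [n|n|]; first exact: rpred0.
  by rewrite /setvars comp_mpoly0.
by exists 0%N => n; rewrite msize0.
Qed.

Lemma symfun1 : is_symfun (fun=> 1).
Proof.
split=> [n|n|]; first exact: rpred1.
  by rewrite /setvars comp_mpoly1.
by exists 1%N => n; rewrite msize1.
Qed.

Lemma symfunN (f : Lambda) : is_symfun (fun n => - f n).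
Proof.
case: f => f [sf cf [D bD]]; split=> [n|n|]; first by rewrite rpredN; apply: sf.
  by rewrite setvarsN cf.
by exists D => n; rewrite msizeN.
Qed.

Lemma symfunD (f g : Lambda) : is_symfun (fun n => f n + g n).
Proof.
case: f g => f [sf cf [D bD]] [g [sg cg [E bE]]] /=.
split=> [n|n|]; first by apply: rpredD; [apply: sf|apply: sg].
  by rewrite setvarsD cf cg.
exists (maxn D E) => n; apply: leq_trans (msizeD_le _ _) _.
by rewrite geq_max !leq_max bD bE orbT.
Qed.

Lemma symfunM (f g : Lambda) : is_symfun (fun n => f n * g n).
Proof.
case: f g => f [sf cf [D bD]] [g [sg cg [E bE]]] /=.
split=> [n|n|]; first by apply: rpredM; [apply: sf|apply: sg].
  by rewrite setvarsM cf cg.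
exists (D + E).+1 => n; apply: leq_trans (msizeM_le _ _) _.
by rewrite ltnS leq_add.
Qed.

Definition Lambda_zero : Lambda := Symfun symfun0.
Definition Lambda_one : Lambda := Symfun symfun1.
Definition Lambda_opp (f : Lambda) : Lambda := Symfun (symfunN f).
Definition Lambda_add (f g : Lambda) : Lambda := Symfun (symfunD f g).
Definition Lambda_mul (f g : Lambda) : Lambda := Symfun (symfunM f g).

Lemma Lambda_addA : associative Lambda_add.
Proof. by move=> f g h; apply: Lambda_eq => n; exact: addrA. Qed.
Lemma Lambda_addC : commutative Lambda_add.
Proof. by move=> f g; apply: Lambda_eq => n; exact: addrC. Qed.
Lemma Lambda_add0 : left_id Lambda_zero Lambda_add.
Proof. by move=> f; apply: Lambda_eq => n; exact: add0r. Qed.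
Lemma Lambda_addN : left_inverse Lambda_zero Lambda_opp Lambda_add.
Proof. by move=> f; apply: Lambda_eq => n; exact: addNr. Qed.

HB.instance Definition _ := GRing.isZmodule.Build Lambda
  Lambda_addA Lambda_addC Lambda_add0 Lambda_addN.

Lemma Lambda_mulA : associative Lambda_mul.
Proof. by move=> f g h; apply: Lambda_eq => n; exact: mulrA. Qed.
Lemma Lambda_mulC : commutative Lambda_mul.
Proof. by move=> f g; apply: Lambda_eq => n; exact: mulrC. Qed.
Lemma Lambda_mul1 : left_id Lambda_one Lambda_mul.
Proof. by move=> f; apply: Lambda_eq => n; exact: mul1r. Qed.
Lemma Lambda_mulD : left_distributive Lambda_mul +%R.
Proof. by move=> f g h; apply: Lambda_eq => n; exact: mulrDl. Qed.
Lemma Lambda_1neq0 : Lambda_one != 0.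
Proof.
apply/eqP => /(congr1 (fun f : Lambda => trunc f 0)) /eqP.
by rewrite /= oner_eq0.
Qed.

HB.instance Definition _ := GRing.Zmodule_isComNzRing.Build Lambda
  Lambda_mulA Lambda_mulC Lambda_mul1 Lambda_mulD Lambda_1neq0.

Lemma truncD (f g : Lambda) n : (f + g) n = f n + g n.
Proof. by []. Qed.
Lemma truncB (f g : Lambda) n : (f - g) n = f n - g n.
Proof. by []. Qed.
Lemma truncM (f g : Lambda) n : (f * g) n = f n * g n.
Proof. by []. Qed.
Lemma trunc1 n : (1 : Lambda) n = 1.
Proof. by []. Qed.

Lemma xvarE n (i : 'I_n) : xvar n i = 'X_i.
Proof. by rewrite /xvar valK. Qed.

Lemma xvar_ge n i : (n <= i)%N -> xvar n i = 0.
Proof. by move=> ni; rewrite /xvar insubF // ltnNge ni. Qed.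

Lemma comp_mpolyA m n k (p : {mpoly int[m]}) (a : m.-tuple {mpoly int[n]})
    (b : n.-tuple {mpoly int[k]}) :
  (p \mPo a) \mPo b = p \mPo [tuple tnth a i \mPo b | i < m].
Proof.
rewrite [p \mPo a]comp_mpolyE raddf_sum [RHS]comp_mpolyE /=.
apply: eq_bigr => u _; rewrite comp_mpolyZ rmorph_prod; congr (_ *: _).
by apply: eq_bigr => i _; rewrite rmorphXn tnth_mktuple.
Qed.

Lemma setvars_comp N M k (y : nat -> {mpoly int[k]}) t :
  (forall i, (M <= i < N)%N -> y i = 0) ->
  setvars N M t \mPo [tuple y i | i < M] = t \mPo [tuple y i | i < N].
Proof.
move=> y0; rewrite /setvars comp_mpolyA; congr (_ \mPo _).
apply: eq_from_tnth => i; rewrite !tnth_mktuple.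
have [iM|Mi] := ltnP i M.
  by rewrite -[nat_of_ord i]/(nat_of_ord (Ordinal iM)) xvarE comp_mpolyXU
    -tnth_nth tnth_mktuple.
by rewrite xvar_ge // comp_mpoly0 y0 // Mi ltn_ord.
Qed.

Lemma setvars_mesym n k : setvars n.+1 n (mesym n.+1 int k) = mesym n int k.
Proof.
have mw (p : {mpoly int[n]}) : setvars n.+1 n (mwiden p) = p.
  rewrite [p]mpolyE !raddf_sum /= /setvars raddf_sum /=; apply: eq_bigr => m _.
  rewrite mwidenZ comp_mpolyZ mwidenX comp_mpolyX; congr (_ *: _).
  rewrite big_ord_recr /= mnmwiden_ordmax expr0 mulr1 [RHS]mpolyXE_id.
  apply: eq_bigr => i _.
  by rewrite mnmwiden_widen tnth_mktuple (xvarE i).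
case: k => [|k]; first by rewrite !mesym0E /setvars comp_mpoly1.
rewrite mesymSS setvarsD setvarsM !mw /setvars comp_mpolyXU.
by rewrite -tnth_nth tnth_mktuple xvar_ge // mulr0 addr0.
Qed.

Definition elem_trunc (k n : nat) : {mpoly int[n]} := mesym n int k.

Lemma elem_truncP k : is_symfun (elem_trunc k).
Proof.
split=> [n|n|]; first exact: mesym_sym.
  exact: setvars_mesym.
exists k.+1 => n; rewrite msizeE; apply/bigmax_leqP_seq => m.
by rewrite mem_msupp_mesym => /andP[/eqP ->].
Qed.

Definition elem (k : nat) : Lambda := Symfun (elem_truncP k).

(* f is the polynomial t in the first N elementary symmetric functions. *)
Definition rep (f : Lambda) N (t : {mpoly int[N]}) :=
  forall n, f n = t \mPo [tuple mesym n int i.+1 | i < N].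

Lemma rep_pad f N M (t : {mpoly int[N]}) :
  (N <= M)%N -> rep f t -> rep f (setvars N M t).
Proof.
move=> NM ft n; rewrite (setvars_comp (y := fun i => mesym n int i.+1)) //.
by move=> i /andP[Mi iN]; move: (leq_trans iN NM); rewrite ltnNge Mi.
Qed.

Lemma rep_inj f N (t t' : {mpoly int[N]}) : rep f t -> rep f t' -> t = t'.
Proof. by move=> ft ft'; apply: msym_fundamental_un; rewrite -ft -ft'. Qed.

Lemma rep_ex (f : Lambda) : exists N (t : {mpoly int[N]}), rep f t.
Proof.
have [sf cf [D bD]] := truncP f.
have down n (t : {mpoly int[D]}) k :
    f (k + n)%N = t \mPo [tuple mesym (k + n) int i.+1 | i < D] ->
    f n = t \mPo [tuple mesym n int i.+1 | i < D].
  elim: k => // k IH E; apply: IH; rewrite -cf E /setvars comp_mpolyA.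
  congr (_ \mPo _); apply: eq_from_tnth => i; rewrite !tnth_mktuple.
  exact: setvars_mesym.
have big n : (D <= n)%N -> exists t : {mpoly int[D]},
    f n = t \mPo [tuple mesym n int i.+1 | i < D].
  move=> Dn; have [t [tE wt]] := sym_fundamental (sf n).
  rewrite -tE.
  exists (setvars n D t).
  pose y i := if (i < D)%N then mesym n int i.+1 else 0.
  transitivity (t \mPo [tuple y i | i < n]).
    rewrite [LHS]comp_mpolyE [RHS]comp_mpolyE big_seq [RHS]big_seq.
    apply: eq_bigr => m mt; congr (_ *: _); apply: eq_bigr => i _.
    rewrite !tnth_mktuple /y; case: ltnP => // Di.
    suff -> : m i = 0%N by rewrite !expr0.
    apply/eqP; rewrite -leqn0 leqNgt; apply/negP => mi.
    have := leq_trans (mmeasure_mnm_lt _ mt) (leq_trans wt (bD n)).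
    rewrite /= /mnmwgt (bigD1 i) //= => /(leq_ltn_trans (leq_addr _ _)).
    have := leq_mul mi (leqW Di); rewrite mul1n => DM.
    by move=> /(leq_ltn_trans DM); rewrite ltnn.
  rewrite -(setvars_comp (M := D)); last by move=> i; rewrite /y ltnNge; case: leqP.
  congr (_ \mPo _); apply: eq_from_tnth => i.
  by rewrite !tnth_mktuple /y ltn_ord.
have [t ft] := big D (leqnn D); exists D, t => n.
have [nD|/ltnW Dn] := leqP n D.
  by apply: (down n t (D - n)%N); rewrite subnK.
have [t' ft'] := big n Dn; rewrite ft'; congr (_ \mPo _).
apply: msym_fundamental_un; rewrite -[RHS]ft; apply/esym.
by apply: (down D t' (n - D)%N); rewrite subnK.
Qed.

(* The fundamental theorem of symmetric functions: a ring homomorphism on Lambda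
   may take arbitrary values on the e_k, k > 0. *)
Lemma Lambda_spec m (y : nat -> {mpoly int[m]}) : y 0 = 1 ->
  exists phi : {rmorphism Lambda -> {mpoly int[m]}}, forall k, phi (elem k) = y k.
Proof.
move=> y0; pose ev N (t : {mpoly int[N]}) := t \mPo [tuple y i.+1 | i < N].
have ev_pad N M (t : {mpoly int[N]}) : (N <= M)%N -> ev M (setvars N M t) = ev N t.
  move=> NM; rewrite /ev (setvars_comp (y := fun i => y i.+1)) //.
  by move=> i /andP[Mi iN]; move: (leq_trans iN NM); rewrite ltnNge Mi.
have [c cP] : exists c : Lambda -> {mpoly int[m]},
    forall f N (t : {mpoly int[N]}), rep f t -> c f = ev N t.
  pose N0 f := projT1 (cid (rep_ex f)); pose t0 f := cid (projT2 (cid (rep_ex f))).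
  exists (fun f => ev (N0 f) (projT1 (t0 f))) => f N t ft.
  have ft0 := projT2 (t0 f).
  rewrite -(ev_pad _ _ _ (leq_maxl (N0 f) N)) -[RHS](ev_pad _ _ _ (leq_maxr (N0 f) N)).
  by congr ev; apply: rep_inj; apply: rep_pad ft0 || apply: rep_pad ft;
    rewrite ?leq_maxl ?leq_maxr.
have rep2 f g : exists N (t u : {mpoly int[N]}), rep f t /\ rep g u.
  have [N [t ft]] := rep_ex f; have [M [u gu]] := rep_ex g.
  exists (maxn N M), (setvars _ _ t), (setvars _ _ u).
  by split; apply: rep_pad => //; rewrite ?leq_maxl ?leq_maxr.
have cB : {morph c : f g / f - g}.
  move=> f g; have [N [t [u [ft gu]]]] := rep2 f g.
  rewrite (cP f _ _ ft) (cP g _ _ gu) (cP _ N (t - u)) /ev ?comp_mpolyB // => n.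
  by rewrite truncB ft gu comp_mpolyB.
have cM : {morph c : f g / f * g}.
  move=> f g; have [N [t [u [ft gu]]]] := rep2 f g.
  rewrite (cP f _ _ ft) (cP g _ _ gu) (cP _ N (t * u)) /ev ?rmorphM // => n.
  by rewrite truncM ft gu rmorphM.
have c1 : c 1 = 1.
  by rewrite (cP _ 0 1) /ev ?comp_mpoly1 // => n; rewrite comp_mpoly1.
pose cA := GRing.isZmodMorphism.Build _ _ c cB.
pose cR := GRing.isMonoidMorphism.Build _ _ c (c1, cM).
pose phi : {rmorphism Lambda -> {mpoly int[m]}} :=
  HB.pack_for {rmorphism Lambda -> {mpoly int[m]}} c cA cR.
exists phi; case=> [|k] /=.
  by rewrite (cP _ 0 1) /ev ?comp_mpoly1 ?y0 // => n; rewrite comp_mpoly1 -mesym0E.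
rewrite (cP _ k.+1 'X_ord_max) /ev.
  by rewrite comp_mpolyXU -tnth_nth tnth_mktuple.
by move=> n; rewrite comp_mpolyXU -tnth_nth tnth_mktuple.
Qed.

(* Partitions are weakly decreasing sequences of positive integers; rows and
   columns are numbered from 0, so lambda_{i+1} is [nth 0 lam i] and
   lambda'_{j+1} is [conj_part lam j]. *)
Definition is_partition (lam : seq nat) : bool :=
  sorted geq lam && (0%N \notin lam).

Definition part (lam : seq nat) (i : nat) : nat := nth 0%N lam i.

Definition conj_part (lam : seq nat) (j : nat) : nat := count (ltn j) lam.

Definition included (mu lam : seq nat) : Prop :=
  forall i, (part mu i <= part lam i)%N.

(* For empty lam, the last column lambda'_{lambda_1} is read as 0. *)
Definition cylindric_shape (lam mu : seq nat) (d : nat) : Prop :=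
  let last := (part lam 0).-1 in
  [/\ is_partition lam, is_partition mu, included mu lam
    & (maxn (conj_part lam 0 - conj_part lam last)
            (conj_part mu 0 - conj_part mu last) <= d <= conj_part lam 0)%N].

Definition box (lam mu : seq nat) : Type :=
  {b : 'I_(size lam) * 'I_(part lam 0) | (part mu b.1 <= b.2 < part lam b.1)%N}.
HB.instance Definition _ lam mu := Finite.on (box lam mu).

Section Tableaux.
Context (disp : Order.disp_t) (P : finPOrderType disp).

Definition three_plus_one_free : Prop :=
  ~ exists a b c x : P,
      [/\ (a < b)%O, (b < c)%O, (x >< a)%O, (x >< b)%O & (x >< c)%O].

(* A filling of a skew shape is seen as a partial function on N x N whose
   domain is the shape. *)
Definition is_Ptableau (F : nat -> nat -> option P) : Prop :=
  (forall i j a b, F i j = Some a -> F i.+1 j = Some b -> (a < b)%O) /\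
  (forall i j a b, F i j = Some a -> F i j.+1 = Some b -> ~ (a > b)%O).

Definition filling lam mu (T : {ffun box lam mu -> P}) (i j : nat) : option P :=
  omap T [pick b : box lam mu | ((val b).1 == i :> nat) && ((val b).2 == j :> nat)].

(* T^d, where F is the filling T and l = lambda_1.  The shape nu/theta of T^d is
   the domain of the resulting partial function. *)
Definition glue (l d : nat) (F : nat -> nat -> option P) (r c : nat) : option P :=
  if (c < l)%N then (if (d <= r)%N then F (r - d)%N c else None)
  else if c == l then F r 0%N else None.

Definition CT lam mu d : {set {ffun box lam mu -> P}} :=
  [set T | `[< is_Ptableau (glue (part lam 0) d (filling T)) >]].

Definition u (p : P) : {mpoly int[#|P|]} := 'X_(enum_rank p).

Definition u_tab lam mu (T : {ffun box lam mu -> P}) : {mpoly int[#|P|]} :=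
  \prod_b u (T b).

Definition elemP (k : nat) : {mpoly int[#|P|]} :=
  \sum_(t : k.-tuple P | sorted <%O t) \prod_(p <- t) u p.

Lemma elemP0 : elemP 0 = 1.
Proof.
rewrite /elemP (bigD1 [tuple]) //= big_nil big1 ?addr0 // => t.
by case/andP=> _ /eqP[]; exact: tuple0.
Qed.

(* The ring homomorphism of [Lambda_spec] is unique because Lambda is generated
   by the e_k. *)
Definition psi : {rmorphism Lambda -> {mpoly int[#|P|]}} :=
  projT1 (cid (Lambda_spec elemP0)).

Lemma psi_elem k : psi (elem k) = elemP k.
Proof. exact: (projT2 (cid (Lambda_spec elemP0))). Qed.

End Tableaux.
Arguments CT {disp} P lam mu d.
Arguments psi {disp} P.

(* The truncation of the cylindric Schur function to n variables: only the
   cylindric semistandard tableaux with entries among the n smallest values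
   contribute, and these are the cylindric P-tableaux for the n-element chain P = 'I_n. *)
Definition cyl_schur_trunc lam mu d (n : nat) : {mpoly int[n]} :=
  \sum_(T in CT 'I_n lam mu d) \prod_b 'X_(T b).

(* For a cylindric shape the truncations always form a symmetric function, so
   the default value 0 is not used. *)
Definition cyl_schur lam mu d : Lambda :=
  if pselect (is_symfun (cyl_schur_trunc lam mu d)) is left h
  then Symfun h else 0.

Definition cyl_schurP (disp : Order.disp_t) (P : finPOrderType disp) lam mu d :
  {mpoly int[#|P|]} := psi P (cyl_schur lam mu d).
Arguments cyl_schurP {disp} P lam mu d.

(* Main.v *)
Require Import Defs.
From HB Require Import structures.
From mathcomp Require Import all_boot all_order all_algebra.
From mathcomp Require Import boolp.
From mathcomp Require Import mpoly.
From mathcomp Require Import fingroup perm zify.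

Set Implicit Arguments.
Unset Strict Implicit.
Unset Printing Implicit Defensive.

Import Order.TTheory GRing.Theory.

(** Both the truncations of the cylindric Schur function and the sum over
    cylindric P-tableaux are instances of one identity.  For every
    (3+1)-free poset P and all weights w on P, the weighted sum over
    cylindric P-tableaux equals the cylindric Jacobi-Trudi expression in
    the weighted sums over k-element chains ([jacobi_trudi_tableaux]).  That
    expression does not depend on P.  The chain with n elements has the
    elementary symmetric polynomials as its chain sums, so the cylindric
    Schur function is the Jacobi-Trudi expression in the [elem k]
    ([cyl_schurE]); in particular it is symmetric.  Since psi maps [elem k]
    to [elemP k], applying the identity to P itself finishes the proof.

    The identity is proved by a sign-reversing involution in the manner of
    Gasharov and of Gessel and Krattenthaler.  Expanding the products of
    chain sums gives a signed sum over pairs of a permutation and a family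
    of chains, placed as the columns of an array on the cylinder; the
    permutation records where the columns end.  A flaw is an entry whose
    left neighbour is greater than it or lies below the end of the left
    column.  At a suitable flaw, the two columns exchange their tails: this
    composes the permutation with a transposition and keeps the entries.  A
    family without flaws occurs only with the identity permutation, by
    [narrow_rigid], and is then a cylindric P-tableau.

    The point is which flaw to exchange at.  In a planar array one takes the
    topmost row and breaks ties by the column, but on a cylinder neither
    rows nor columns have a first element.  Here the flaw is chosen to
    minimise the number of elements of P below its right entry b.  Two
    facts make this work.  Entries above b in its column carry no flaw, so
    (3+1)-freeness shows that the exchanged tails fit ([sorted_left]).  And
    the exchange creates no flaw that would be chosen instead
    ([flawed_swap_key]), again by (3+1)-freeness, so that the exchange at
    the chosen flaw undoes itself. *)

(** * Entries of sequences *)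

Section Onth.
Context (T : Type).
Implicit Types s : seq T.

Lemma onth_take k s i : onth (take k s) i = if i < k then onth s i else None.
Proof.
by elim: s k i => [|x s IH] [|k] [|i] //=; rewrite ?onth0n ?if_same // IH ltnS.
Qed.

Lemma onth_drop k s i : onth (drop k s) i = onth s (k + i).
Proof. by elim: s k i => [|x s IH] [|k] i //=; rewrite ?onth0n // IH. Qed.

Lemma onth_some s i : i < size s -> exists x, onth s i = Some x.
Proof. by rewrite -onthTE; case: onth => // x _; exists x. Qed.

Lemma onth_size s i x : onth s i = Some x -> i < size s.
Proof. by rewrite -onthTE => ->. Qed.

End Onth.

(** * Exchanging the tails of two chains *)

Section Chains.
Context (disp : Order.disp_t) (P : porderType disp).
Implicit Types (A B : seq P) (a b x y : P).

Lemma sorted_onthP A :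
  reflect (forall i j a b, i < j -> onth A i = Some a -> onth A j = Some b ->
             (a < b)%O)
          (sorted <%O A).
Proof.
rewrite (sorted_pairwise lt_trans); apply: (iffP idP).
  move=> pA i j a b ij Ai Aj.
  have iA := onth_size Ai; have jA := onth_size Aj.
  have := pairwiseP a pA i j iA jA ij.
  by rewrite (onth_nth _ _ _ _ Ai) (onth_nth _ _ _ _ Aj).
move=> H; case: A H => // x A H; apply/(pairwiseP x) => i j iA jA ij.
have [a Ai] := onth_some iA; have [b Aj] := onth_some jA.
by rewrite (onth_nth _ _ _ _ Ai) (onth_nth _ _ _ _ Aj); exact: H ij Ai Aj.
Qed.

Lemma sorted_lt A i j a b : sorted <%O A -> i < j ->
  onth A i = Some a -> onth A j = Some b -> (a < b)%O.
Proof. by move/sorted_onthP; apply. Qed.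

Lemma sorted_onth_stepP A :
  reflect (forall i a b, onth A i = Some a -> onth A i.+1 = Some b -> (a < b)%O)
          (sorted <%O A).
Proof.
apply: (iffP idP) => [/sorted_onthP H i a b|H]; first exact: H.
apply/sorted_onthP => i j a b; elim: j b => // j IH b ij Ai Aj.
have [eij|ji] := eqVneq i j; first by subst j; exact: H Ai Aj.
have [c Ac] := onth_some (ltnW (onth_size Aj)).
apply: lt_trans (IH c _ Ai Ac) (H _ _ _ Ac Aj); lia.
Qed.

(** The chains A and B are adjacent columns, A on the left, and position
    [i + g] of B lies in the same row as position i of A.  Beyond the end of
    A every entry of B is a flaw; the absence of flaws thus also forces B to
    end no lower than A. *)
Definition flaw g A B i : bool :=
  if onth B (i + g) is Some b
  then (if onth A i is Some a then (b < a)%O else true) else false.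

(** The entry of B at the flaw stays in the right column, so that the left
    column receives the tail of B moved up by one row, and the right column
    that of A moved down by one row. *)
Definition tails_left g A B i := take i A ++ drop (i + g).+1 B.
Definition tails_right g A B i := take (i + g).+1 B ++ drop i A.

Lemma perm_tails g A B i :
  perm_eq (tails_left g A B i ++ tails_right g A B i) (A ++ B).
Proof.
apply/seq.permP => p; rewrite !count_cat.
have := congr1 (count p) (cat_take_drop i A).
have := congr1 (count p) (cat_take_drop (i + g).+1 B).
by rewrite !count_cat; lia.
Qed.

Section Swap.
Context (g : nat) (A B : seq P) (i : nat).
Hypotheses (fi : flaw g A B i) (ftop : forall k, k < i -> ~~ flaw g A B k).

Lemma flaw_ltB : i + g < size B.
Proof.
by move: fi; rewrite /flaw; case E: onth => // _; exact: onth_size E.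
Qed.

(** Were the flaw further down, the entry just above it would be a flaw for
    the same reason: the left column has already ended. *)
Lemma flaw_leA : i <= size A.
Proof.
have iB := flaw_ltB; rewrite leqNgt; apply/negP => Ai.
have iB' : i.-1 + g < size B by lia.
have [b Bb] := onth_some iB'.
have /ftop : i.-1 < i by lia.
by rewrite /flaw Bb onth_default //; lia.
Qed.

Lemma onth_left k :
  onth (tails_left g A B i) k = if k < i then onth A k else onth B (k + g.+1).
Proof.
have iA := flaw_leA; rewrite onth_cat size_takel // onth_take onth_drop.
by case: ltnP => // ki; congr onth; lia.
Qed.

Lemma onth_right k :
  onth (tails_right g A B i) k =
    if k <= i + g then onth B k else onth A (k - g.+1).
Proof.
have iB := flaw_ltB; rewrite onth_cat size_takel // onth_take onth_drop ltnS.
by case: leqP => // ki; congr onth; lia.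
Qed.

Lemma size_left : size (tails_left g A B i) + g.+1 = size B.
Proof.
have iA := flaw_leA; have iB := flaw_ltB.
by rewrite size_cat size_takel // size_drop; lia.
Qed.

Lemma size_right : size (tails_right g A B i) = size A + g.+1.
Proof.
have iA := flaw_leA; have iB := flaw_ltB.
by rewrite size_cat size_takel // size_drop; lia.
Qed.

Lemma tails_leftK :
  tails_left g (tails_left g A B i) (tails_right g A B i) i = A.
Proof.
have iA := flaw_leA; have iB := flaw_ltB.
apply: eq_from_onth => k; rewrite /tails_left /tails_right.
rewrite take_size_cat ?size_takel // drop_size_cat ?size_takel //.
by rewrite cat_take_drop.
Qed.

Lemma tails_rightK :
  tails_right g (tails_left g A B i) (tails_right g A B i) i = B.
Proof.
have iA := flaw_leA; have iB := flaw_ltB.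
apply: eq_from_onth => k; rewrite /tails_left /tails_right.
rewrite take_size_cat ?size_takel // drop_size_cat ?size_takel //.
by rewrite cat_take_drop.
Qed.

Hypotheses (sA : sorted <%O A) (sB : sorted <%O B).

(** The entry b at the flaw is still there, and its new left neighbour is the
    former successor of b, or missing. *)
Lemma flaw_swap : flaw g (tails_left g A B i) (tails_right g A B i) i.
Proof.
move: fi; rewrite /flaw onth_left onth_right leqnn ltnn.
case Bb: onth => [b|] // _; case Bc: onth => [c|] //.
by apply: (sorted_lt sB _ Bb Bc); lia.
Qed.

(** The flaw b lies below the entry of A in its row, hence below the whole
    tail of A that is attached to b. *)
Lemma sorted_right : sorted <%O (tails_right g A B i).
Proof.
apply/sorted_onthP => j k x y jk; rewrite !onth_right.
case: (leqP k) => [ki|ik]; first by rewrite (leq_trans (ltnW jk) ki);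
  apply: sorted_lt sB _.
case: (leqP j) => [ji|ij]; last by apply: sorted_lt sA _; lia.
move=> Bx Ay; move: fi; rewrite /flaw.
have [a Aa] : exists a, onth A i = Some a.
  by apply: onth_some; have := onth_size Ay; lia.
case Bb: onth => [b|] //; rewrite Aa => ba.
have xb : (x <= b)%O.
  have [e|ne] := eqVneq j (i + g); first by move: Bx; rewrite e Bb => -[->].
  by apply/ltW; apply: (sorted_lt sB _ Bx Bb); lia.
have ay : (a <= y)%O.
  have [e|ne] := eqVneq (k - g.+1) i; first by move: Ay; rewrite e Aa => -[->].
  by apply/ltW; apply: (sorted_lt sA _ Aa Ay); lia.
by apply: le_lt_trans xb (lt_le_trans ba ay).
Qed.

End Swap.
End Chains.

(** * The role of (3+1)-freeness *)

Section ThreePlusOne.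
Context (disp : Order.disp_t) (P : finPOrderType disp).
Hypothesis P_free : three_plus_one_free P.
Implicit Types (A B : seq P) (a b c x y : P).

(** Otherwise x would be incomparable to each element of the chain a < b < c. *)
Lemma free_comparable a b c x : (a < b)%O -> (b < c)%O ->
  ~~ (a < x)%O -> ~~ (x < c)%O -> False.
Proof.
move=> ab bc nax nxc; apply: P_free; exists a, b, c, x.
have ac := lt_trans ab bc; split=> //; rewrite /Order.comparable; apply/negP.
- case/orP=> [xa|]; first by rewrite (le_lt_trans xa ac) in nxc.
  by rewrite le_eqVlt (negPf nax) orbF => /eqP ax; rewrite -ax ac in nxc.
- by case/orP=> [xb|bx]; [rewrite (le_lt_trans xb bc) in nxc
                         |rewrite (lt_le_trans ab bx) in nax].
- case/orP=> [|cx]; last by rewrite (lt_le_trans ac cx) in nax.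
  by rewrite le_eqVlt (negPf nxc) orbF => /eqP xc; rewrite xc ac in nax.
Qed.

(** This is where (3+1)-freeness makes the exchange possible.  Let x be an entry
    of A above the flaw, and y an entry of B below it.  The right neighbour b'
    of x, the flaw b and y form a chain, and b' is not below x because b' is
    not a flaw; hence x < y. *)
Lemma sorted_left g A B i :
  flaw g A B i -> (forall k, k < i -> ~~ flaw g A B k) ->
  sorted <%O A -> sorted <%O B -> sorted <%O (tails_left g A B i).
Proof.
move=> fi ftop sA sB; have iB : i + g < size B := flaw_ltB fi.
apply/sorted_onthP => j k x y jk; rewrite !onth_left //.
case: (ltnP k) => [ki|ik]; first by rewrite (ltn_trans jk ki);
  apply: sorted_lt sA _.
case: (ltnP j) => [ji|ij]; last by apply: sorted_lt sB _; lia.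
move=> Ax By.
have [b Bb] := onth_some iB; have /onth_some[b' Bb'] : j + g < size B by lia.
have b'b : (b' < b)%O by apply: (sorted_lt sB _ Bb' Bb); lia.
have b_y : (b < y)%O by apply: (sorted_lt sB _ Bb By); lia.
have := ftop j ji; rewrite /flaw Bb' Ax => nb'x.
by apply: contraT => nxy; case: (free_comparable b'b b_y nb'x nxy).
Qed.

(** A number rather than the down-set itself, so that any two flaws can be
    compared.  Besides being strictly monotone, it controls inclusions: if x
    has at most as many elements below it as y, then either its down-set lies
    in that of y or y has an element below it that x lacks ([down_witness]). *)
Definition down x := #|[set y | (y < x)%O]|.

Lemma down_lt x y : (x < y)%O -> down x < down y.
Proof.
move=> xy; apply: proper_card; apply/properP; split.
  by apply/subsetP => z; rewrite !inE => /lt_trans; apply.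
by exists x; rewrite !inE ?ltxx.
Qed.

Lemma down_witness x y z : down x <= down y -> (z < x)%O -> ~~ (z < y)%O ->
  exists2 t, (t < y)%O & ~~ (t < x)%O.
Proof.
move=> xy zx nzy; have : ~~ ([set t | (t < y)%O] \subset [set t | (t < x)%O]).
  apply/negP => sub; move: xy; rewrite leqNgt => /negP; apply.
  by apply: proper_card; apply/properP; split=> //; exists z; rewrite inE.
by case/subsetPn => t; rewrite !inE => ty ntx; exists t.
Qed.

End ThreePlusOne.

(** * The least flaw of a cyclic family of chains *)

Section CyclicFamily.
Context (disp : Order.disp_t) (P : finPOrderType disp).
Hypothesis P_free : three_plus_one_free P.
Context (I : eqType) (next : I -> I) (gap : I -> nat).
Hypothesis next_inj : injective next.
Implicit Types (f : I -> seq P) (c : I) (i : nat).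

(** On the cylinder the column to the right of c is [next c], and
    [gap c] aligns the rows of the two columns. *)
Definition flawed f c i := flaw (gap c) (f c) (f (next c)) i.

Definition key f c i :=
  if onth (f (next c)) (i + gap c) is Some b then down b else 0.

Definition swap f c i : I -> seq P := fun j =>
  if j == c then tails_left (gap c) (f c) (f (next c)) i
  else if j == next c then tails_right (gap c) (f c) (f (next c)) i else f j.

Lemma flawedP f c i : flawed f c i -> exists b,
  [/\ onth (f (next c)) (i + gap c) = Some b, key f c i = down b
    & forall a, onth (f c) i = Some a -> (b < a)%O].
Proof.
rewrite /flawed /flaw /key; case Eb: onth => [b|] //.
by case Ea: onth => [a|] ba; exists b; split=> // a' [<-].
Qed.

Section Least.
Context (f : I -> seq P) (c : I) (i : nat).
Hypotheses (f_sorted : forall j, sorted <%O (f j)) (fci : flawed f c i).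
Hypothesis f_least : forall c' i', flawed f c' i' -> key f c i <= key f c' i'.

(** Entries increase down a column, so a flaw above the chosen one would have
    a smaller key. *)
Lemma least_top k : k < i -> ~~ flawed f c k.
Proof.
move=> ki; apply/negP => fk; have := f_least fk; rewrite leqNgt => /negP; apply.
have [b [Eb -> _]] := flawedP fci; have [b' [Eb' -> _]] := flawedP fk.
by apply/down_lt/(sorted_lt (f_sorted _) _ Eb' Eb); rewrite ltn_add2r.
Qed.

(** A column adjacent to itself carries no flaw: the right neighbour of an
    entry is an entry further down the same chain. *)
Lemma flawed_neq : (c == next c) = false.
Proof.
apply/negP => /eqP cc; move: fci; rewrite /flawed /flaw -cc.
case Eb: onth => [b|] //; have iA := onth_size Eb.
have /onth_some[a Ea] : i < size (f c) by apply: leq_ltn_trans iA; lia.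
rewrite Ea => ba; have : (a <= b)%O; last by rewrite (lt_geF ba).
have [g0|g0] := posnP (gap c).
  by move: Eb; rewrite g0 addn0 Ea => -[->].
by apply/ltW/(sorted_lt (f_sorted c) _ Ea Eb); lia.
Qed.

Lemma swap_left : swap f c i c = tails_left (gap c) (f c) (f (next c)) i.
Proof. by rewrite /swap eqxx. Qed.

Lemma swap_right :
  swap f c i (next c) = tails_right (gap c) (f c) (f (next c)) i.
Proof. by rewrite /swap eq_sym flawed_neq eqxx. Qed.

Lemma swap_other j : j != c -> j != next c -> swap f c i j = f j.
Proof. by rewrite /swap => /negPf -> /negPf ->. Qed.

Lemma swap_sorted j : sorted <%O (swap f c i j).
Proof.
rewrite /swap; case: eqP => _.
  by apply: sorted_left => //; exact: least_top.
by case: eqP => _ //; apply: sorted_right => //; exact: least_top.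
Qed.

Lemma swapK : swap (swap f c i) c i =1 f.
Proof.
move=> j; have ft := least_top; rewrite {1}/swap swap_left swap_right.
case: eqP => [->|/eqP jc]; first exact: tails_leftK.
by case: eqP => [->|/eqP js]; [exact: tails_rightK|exact: swap_other].
Qed.

Lemma flawed_swap : flawed (swap f c i) c i.
Proof.
by rewrite /flawed swap_left swap_right; apply: flaw_swap => //;
   exact: least_top.
Qed.

Lemma key_swap : key (swap f c i) c i = key f c i.
Proof.
by rewrite /key swap_right onth_right ?leqnn //; exact: least_top.
Qed.

(** New flaws do not compete with the chosen one, whose right entry is b.  A
    cell whose content changes now holds an element above b, so it is harmless
    as the right entry x of a new flaw; so are the cells that were already below
    b in its column.  The remaining case is that only the
    left entry changes, in column [next c] below b.  Let x' be the entry of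
    the column of x in the row of b, so that x' < x.  If x had at most as many
    elements below it as b, then by minimality x' is not below b, so some
    y < b is not below x.  Then y < b < b', where b' is the old left neighbour
    of x, if it exists, and (3+1)-freeness gives x < b': the flaw at x was already there. *)
Lemma flawed_swap_key c' i' : flawed (swap f c i) c' i' ->
  key f c i < key (swap f c i) c' i' \/
  flawed f c' i' /\ key (swap f c i) c' i' = key f c' i'.
Proof.
move=> f'; have [x [Ex -> xa]] := flawedP f'.
have ft := least_top; have [b [Eb -> ba]] := flawedP fci.
have E1 k : onth (swap f c i c) k =
  if k < i then onth (f c) k else onth (f (next c)) (k + (gap c).+1).
  by rewrite swap_left onth_left.
have E2 k : onth (swap f c i (next c)) k =
  if k <= i + gap c then onth (f (next c)) k else onth (f c) (k - (gap c).+1).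
  by rewrite swap_right onth_right.
(* The right cell of the new flaw has a new content: it lies above b. *)
have [Ex'|Ex'] := eqVneq (onth (swap f c i (next c')) (i' + gap c'))
                         (onth (f (next c')) (i' + gap c')); last first.
  left; apply: down_lt.
  have [ec|nc] := eqVneq (next c') c.
    move: Ex Ex'; rewrite ec E1; case: ltnP => [_ _|ik Ex _].
      by rewrite eqxx.
    by apply: (sorted_lt (f_sorted _) _ Eb Ex); lia.
  have [es|ns] := eqVneq (next c') (next c); last first.
    by rewrite swap_other ?eqxx in Ex'.
  move: Ex Ex'; rewrite es E2; case: leqP => [_ _|ik Ex _].
    by rewrite eqxx.
  have /onth_some[a Ea] : i < size (f c).
    by apply: leq_ltn_trans (onth_size Ex); lia.
  have := ba _ Ea; have [e|ne] := eqVneq i (i' + gap c' - (gap c).+1).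
    by move: Ex; rewrite -e Ea => -[->].
  move=> /lt_trans; apply.
  by apply: (sorted_lt (f_sorted _) _ Ea Ex); lia.
rewrite Ex in Ex'; have kE : key f c' i' = down x by rewrite /key -Ex'.
(* If the left cell is unchanged too, then the flaw was already there. *)
have old : onth (swap f c i c') i' = onth (f c') i' -> flawed f c' i'.
  by move: f'; rewrite /flawed /flaw Ex -Ex' => + E; rewrite E.
have [ec|nc] := eqVneq c' c.
  subst c'; case: (ltngtP i' i) => [lt|gt|eq].
  - by right; split=> //; apply: old; rewrite E1 lt.
  - left; apply: down_lt.
    by apply: (sorted_lt (f_sorted _) _ Eb (esym Ex')); lia.
  - by right; split=> //; rewrite eq.
have [es|ns] := eqVneq c' (next c); last first.
  by right; split=> //; apply: old; rewrite swap_other.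
subst c'; have [le|gt] := leqP i' (i + gap c).
  by right; split=> //; apply: old; rewrite E2 le.
have [//|xb] := ltnP (down b) (down x); first by left.
right; split=> //; apply: contraT => nf.
have /onth_some[x' Ex0] : i + gap c + gap (next c) < size (f (next (next c))).
  by apply: leq_ltn_trans (onth_size (esym Ex')); lia.
have x'x : (x' < x)%O by apply: (sorted_lt (f_sorted _) _ Ex0 (esym Ex')); lia.
have nx'b : ~~ (x' < b)%O.
  apply/negP => x'b; have fl : flawed f (next c) (i + gap c).
    by rewrite /flawed /flaw Ex0 Eb x'b.
  have := f_least fl; rewrite /key Ex0 Eb leqNgt => /negP; apply.
  exact: leq_trans (down_lt x'x) xb.
have [y yb nyx] := down_witness xb x'x nx'b.
move: nf; rewrite /flawed /flaw -Ex'; case Eb': onth => [b'|] // nxb'.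
have bb' : (b < b')%O by apply: (sorted_lt (f_sorted _) _ Eb Eb').
by case: (free_comparable P_free yb bb' nyx nxb').
Qed.
End Least.
End CyclicFamily.

Local Open Scope ring_scope.

(** * Cancellation in the signed sum *)

Lemma sum_signed_involution (R : zmodType) (T : finType) (V odd : pred T)
    (inv : T -> T) (F : T -> R) :
  (forall x, V x -> [/\ V (inv x), inv (inv x) = x, odd (inv x) = ~~ odd x
                      & F (inv x) = - F x]) ->
  \sum_(x | V x) F x = 0.
Proof.
move=> H; rewrite (bigID odd) /=.
rewrite [X in X + _](reindex_onto inv inv) /=; last first.
  by move=> x /andP[/H[]].
apply/eqP; rewrite addr_eq0 -sumrN; apply/eqP/eq_big => x.
  apply/idP/idP=> [/andP[/andP[Vx ox] /eqP xK]|/andP[/H[Vx xK -> _] ox]].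
    by have [] := H _ Vx; rewrite xK => -> _ -> _; rewrite ox.
  by rewrite Vx ox xK eqxx.
case/andP=> /andP[Vx _] /eqP xK; have [_ _ _] := H _ Vx.
by rewrite xK => ->; rewrite opprK.
Qed.

Lemma insub_bseqK (T : Type) n (s : seq T) :
  (size s <= n)%N -> insub_bseq n s = s :> seq T.
Proof. by move=> sn; rewrite /insub_bseq /insubd insubT. Qed.

Section Cancellation.
Context (disp : Order.disp_t) (P : finPOrderType disp).
Hypothesis P_free : three_plus_one_free P.
Context (l n M : nat) (h alpha gap : 'I_l -> nat).
Hypothesis h_next : forall c, h c = (h (ordS c) + (gap c).+1)%N %[mod M].
Context (R : comNzRingType) (w : P -> R).

Notation columns := {ffun 'I_l -> n.-bseq P}.
Implicit Types (f : columns) (s : 'S_l) (x y : 'I_l * 'I_n).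

Definition cols f : 'I_l -> seq P := fun j => f j.

Definition chains f := [forall j, sorted <%O (cols f j)].

(** Here [h j] encodes the top of column j, so that [h j + size (cols f j)]
    encodes its bottom, and [alpha] lists the bottoms of the target shape.
    Column j ends where column [s j] of the shape does, up to turns around the
    cylinder; one turn shifts the encoding by M.  The turns add up to 0, which
    is expressed by the total size. *)
Definition admissible s f :=
  (\sum_j size (cols f j) == n)%N &&
  [forall j, h j + size (cols f j) == alpha (s j) %[mod M]]%N.

Definition weight f : R := \prod_j \prod_(p <- cols f j) w p.

Definition flaw_at f x := flawed (@ordS l) gap (cols f) x.1 x.2.

(** The key followed lexicographically by an arbitrary position number, which
    makes the least flaw unique. *)
Definition rank f x : nat :=
  (key (@ordS l) gap (cols f) x.1 x.2 * #|{: 'I_l * 'I_n}| + enum_rank x)%N.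

Definition first_flaw f : option ('I_l * 'I_n) :=
  [pick x | flaw_at f x & [forall y, flaw_at f y ==> (rank f x <= rank f y)%N]].

Definition exchange f x : columns :=
  [ffun j => insub_bseq n (swap (@ordS l) gap (cols f) x.1 x.2 j)].

Definition exchange_first (sf : 'S_l * columns) : 'S_l * columns :=
  if first_flaw sf.2 is Some x
  then ((tperm x.1 (ordS x.1) * sf.1)%g, exchange sf.2 x) else sf.

Lemma rank_key f x g y : (rank f x <= rank g y)%N ->
  (key (@ordS l) gap (cols f) x.1 x.2 <= key (@ordS l) gap (cols g) y.1 y.2)%N.
Proof.
rewrite /rank; set a := key _ _ _ _ _; set b := key _ _ _ _ _; set N := #|_|.
have := ltn_ord (enum_rank y); rewrite -/N => yN; case: (leqP a b) => // ba.
have := leq_mul ba (leqnn N); rewrite mulSn; lia.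
Qed.

Lemma key_rank f x g y :
  (key (@ordS l) gap (cols f) x.1 x.2 < key (@ordS l) gap (cols g) y.1 y.2)%N ->
  (rank f x <= rank g y)%N.
Proof.
by case: (leqP (rank f x)) => // /ltnW/rank_key; rewrite ltnNge => ->.
Qed.

Lemma first_flaw_some f x :
  flaw_at f x -> (forall y, flaw_at f y -> (rank f x <= rank f y)%N) ->
  first_flaw f = Some x.
Proof.
move=> fx xmin; rewrite /first_flaw; case: pickP => [y|/(_ x)]; last first.
  by rewrite /= fx /= => /negbT/forallPn[y]; rewrite negb_imply
    => /andP[fy /negP[]]; exact: xmin.
case/andP=> fy /forallP/(_ x)/implyP/(_ fx) yx; congr Some; apply/esym.
have : rank f x = rank f y by apply/eqP; rewrite eqn_leq yx xmin.
move/(congr1 (modn^~ #|{: 'I_l * 'I_n}|)).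
by rewrite /rank !modnMDl !modn_small // => /val_inj/enum_rank_inj.
Qed.

Lemma first_flaw_least f x : first_flaw f = Some x ->
  flaw_at f x /\ forall y, flaw_at f y -> (rank f x <= rank f y)%N.
Proof.
rewrite /first_flaw; case: pickP => // y /andP[fy /forallP ymin] [<-].
by split=> // z; apply/implyP.
Qed.

Lemma first_flaw_none f : first_flaw f = None ->
  forall c i, ~~ flawed (@ordS l) gap (cols f) c i.
Proof.
move=> fN c i; apply/negP => fc.
have iB := flaw_ltB fc; have iN : (i < n)%N.
  by apply: leq_ltn_trans (leq_addr _ _) (leq_trans iB (size_bseq _)).
have fx : flaw_at f (c, Ordinal iN) by [].
have [y fy ymin] := arg_minnP (rank f) fx.
by rewrite (first_flaw_some fy) in fN.
Qed.

Section Exchange.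
Context (f : columns) (x : 'I_l * 'I_n).
Hypotheses (f_chains : chains f) (f_size : (\sum_j size (cols f j) = n)%N).
Hypothesis fx : first_flaw f = Some x.

Let f_sorted j : sorted <%O (cols f j). Proof. exact: (forallP f_chains). Qed.

Let x_flaw : flawed (@ordS l) gap (cols f) x.1 x.2.
Proof. exact: (first_flaw_least fx).1. Qed.

Let x_least c' i' : flawed (@ordS l) gap (cols f) c' i' ->
  (key (@ordS l) gap (cols f) x.1 x.2 <= key (@ordS l) gap (cols f) c' i')%N.
Proof.
move=> fc; have iB := flaw_ltB fc; have iN : (i' < n)%N.
  by apply: leq_ltn_trans (leq_addr _ _) (leq_trans iB (size_bseq _)).
have fy : flaw_at f (c', Ordinal iN) by [].
exact: rank_key ((first_flaw_least fx).2 _ fy).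
Qed.

Let x_top k : (k < x.2)%N -> ~~ flawed (@ordS l) gap (cols f) x.1 k.
Proof. exact: least_top. Qed.

Let x_neq : (x.1 == ordS x.1) = false.
Proof. exact: flawed_neq f_sorted x_flaw. Qed.

Lemma big_swap (S : Type) (idx : S) (op : Monoid.com_law idx) (G : seq P -> S) :
  {morph G : A B / A ++ B >-> op A B} ->
  (forall A B, perm_eq A B -> G A = G B) ->
  \big[op/idx]_j G (swap (@ordS l) gap (cols f) x.1 x.2 j) =
  \big[op/idx]_j G (cols f j).
Proof.
move=> GD Gperm; rewrite (bigD1 x.1) //= [RHS](bigD1 x.1) //=.
rewrite (bigD1 (ordS x.1)) /=; last by rewrite eq_sym x_neq.
rewrite [in RHS](bigD1 (ordS x.1)) /=; last by rewrite eq_sym x_neq.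
rewrite !Monoid.mulmA swap_left (swap_right f_sorted x_flaw); congr (op _ _).
  apply: etrans (esym (GD _ _)) (etrans _ (GD _ _)).
  by apply: Gperm; exact: perm_tails.
by apply: eq_bigr => j /andP[jc js]; rewrite swap_other.
Qed.

Lemma sum_size_swap :
  (\sum_j size (swap (@ordS l) gap (cols f) x.1 x.2 j) = n)%N.
Proof.
by rewrite -[RHS]f_size big_swap // => A B; [exact: size_cat|exact: perm_size].
Qed.

Lemma cols_exchange :
  cols (exchange f x) =1 swap (@ordS l) gap (cols f) x.1 x.2.
Proof.
move=> j; rewrite /cols ffunE insub_bseqK //.
by rewrite -[X in (_ <= X)%N]sum_size_swap (bigD1 j) //= leq_addr.
Qed.

Lemma weight_exchange : weight (exchange f x) = weight f.
Proof.
rewrite /weight; under eq_bigr do rewrite cols_exchange.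
rewrite (big_swap (G := fun A => \prod_(p <- A) w p)) // => A B.
  exact: big_cat.
exact: perm_big.
Qed.

Lemma chains_exchange : chains (exchange f x).
Proof. by apply/forallP => j; rewrite cols_exchange; exact: swap_sorted. Qed.

Lemma admissible_exchange s : admissible s f ->
  admissible (tperm x.1 (ordS x.1) * s)%g (exchange f x).
Proof.
case/andP=> _ /forallP adm; apply/andP; split.
  by under eq_bigr do rewrite cols_exchange; rewrite sum_size_swap.
apply/forallP => j; rewrite cols_exchange permM.
case: tpermP => [->|->|/eqP jc /eqP js].
- rewrite swap_left -(eqP (adm _)) -modnDml h_next modnDml.
  by rewrite -addnA [((gap _).+1 + _)%N]addnC (size_left x_flaw x_top).
- rewrite (swap_right f_sorted x_flaw) (size_right x_flaw x_top).
  by rewrite [(size _ + _)%N]addnC addnA -modnDml -h_next modnDml.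
- by rewrite swap_other.
Qed.

Lemma exchangeK : exchange (exchange f x) x = f.
Proof.
have E : cols (exchange f x) = swap (@ordS l) gap (cols f) x.1 x.2.
  exact/funext/cols_exchange.
apply/ffunP => j; rewrite ffunE E swapK //; apply/val_inj.
by rewrite /= insub_bseqK // size_bseq.
Qed.

(** The exchange changes neither the rank of the chosen flaw nor that of the
    surviving flaws, and by [flawed_swap_key] the new ones rank higher. *)
Lemma first_flaw_exchange : first_flaw (exchange f x) = Some x.
Proof.
have E : cols (exchange f x) = swap (@ordS l) gap (cols f) x.1 x.2.
  exact/funext/cols_exchange.
have kE : key (@ordS l) gap (cols (exchange f x)) x.1 x.2 =
          key (@ordS l) gap (cols f) x.1 x.2.
  by rewrite E; exact: key_swap.
apply: first_flaw_some; first by rewrite /flaw_at E; exact: flawed_swap.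
move=> y; rewrite /flaw_at E => ey.
have [lt|[fy ky]] := flawed_swap_key P_free f_sorted x_flaw x_least ey.
  by apply: key_rank; rewrite kE E.
have := (first_flaw_least fx).2 y fy.
by rewrite /rank kE E ky.
Qed.

End Exchange.

Definition flawless f := first_flaw f == None.

Lemma sum_flawless :
  \sum_(sf : 'S_l * columns | chains sf.2 && admissible sf.1 sf.2)
     (-1) ^+ sf.1 * weight sf.2 =
  \sum_(sf : 'S_l * columns |
      chains sf.2 && admissible sf.1 sf.2 && flawless sf.2)
     (-1) ^+ sf.1 * weight sf.2.
Proof.
rewrite (bigID (fun sf => flawless sf.2)) /= [X in _ + X](_ : _ = 0) ?addr0 //.
apply: (sum_signed_involution (odd := fun sf => odd_perm sf.1)
                              (inv := exchange_first)).
case=> s f /=; rewrite /exchange_first /flawless /=.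
case fx: first_flaw => [x|]; rewrite ?andbF // andbT => /andP[fc adm].
have fn : (\sum_j size (cols f j) = n)%N by case/andP: (adm) => /eqP.
have [xf _] := first_flaw_least fx.
have neq : x.1 != ordS x.1 by apply/negbT/(flawed_neq (forallP fc) xf).
rewrite /= (first_flaw_exchange fc fn fx) chains_exchange //.
rewrite admissible_exchange //.
split=> //=; first by rewrite exchangeK // mulgA tperm2 mul1g.
  by rewrite odd_mul_tperm neq.
rewrite weight_exchange // odd_mul_tperm neq signr_addb /=.
by rewrite expr1 mulN1r mulNr.
Qed.

End Cancellation.

(** * Families without flaws *)

Section Rigidity.
Context (l M : nat).
Local Open Scope nat_scope.

Lemma leq_sum_eq (a b : 'I_l -> nat) :
  (forall j, a j <= b j) -> \sum_j a j = \sum_j b j -> a =1 b.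
Proof.
move=> ab E j; have [_] := leqif_sum (fun i (_ : true) => leqif_eq (ab i)).
by rewrite E eqxx => /esym/forallP/(_ j)/eqP.
Qed.

Lemma perm_mono_id (s : 'S_l) :
  (forall i j : 'I_l, i < j -> s i < s j) -> s = 1%g.
Proof.
move=> s_mono; have s_ge k (j : 'I_l) : j = k :> nat -> k <= s j.
  elim: k j => // k IH j jk; have kl : k < l by rewrite ltnW // -jk.
  have := s_mono (Ordinal kl) j; rewrite jk => /(_ (leqnn _)).
  by apply: leq_ltn_trans; exact: IH.
have E : \sum_(j < l) j = \sum_(j < l) s j.
  by rewrite [LHS](reindex_inj (@perm_inj _ s)).
apply/permP => j; rewrite perm1; apply/val_inj/esym.
exact: (leq_sum_eq (fun i => s_ge i i erefl) E).
Qed.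

(** The values of v over one turn, continued by [v (j + l) = v j - M], form a
    strictly decreasing sequence indexed by the integers. *)
Definition narrow (v : 'I_l -> nat) :=
  forall i j : 'I_l, i < j -> v j < v i /\ v i < v j + M.

Lemma narrow_step (v : 'I_l -> nat) :
  (forall c : 'I_l, v (ordS c) < v c + (if c.+1 == l then M else 0)) ->
  narrow v.
Proof.
move=> step; have mono k (i j : 'I_l) : j = i + k :> nat -> v j + k <= v i.
  elim: k j => [|k IH] j jk.
    by rewrite addn0 (_ : j = i) //; apply/val_inj; rewrite /= jk addn0.
  have kl : i + k < l by rewrite -ltnS -addnS -jk ltnS ltnW.
  have := step (Ordinal kl); rewrite (_ : ordS _ = j); last first.
    by apply/val_inj; rewrite /= -addnS -jk modn_small.
  rewrite /= -addnS -jk ltn_eqF // addn0 => lt.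
  by have := IH (Ordinal kl) erefl; lia.
move=> i j ij; split.
  have := mono (j - i) i j; lia.
have ll : l.-1 < l by have := ltn_ord i; lia.
have l0 : 0 < l by lia.
have := step (Ordinal ll); rewrite (_ : ordS _ = Ordinal l0); last first.
  by apply/val_inj; rewrite /= prednK // modnn.
rewrite /= prednK // eqxx.
have m0 := mono i (Ordinal l0) i erefl.
have jl : j <= l.-1 by have := ltn_ord j; lia.
have := mono (l.-1 - j) j (Ordinal ll); rewrite /= subnKC // => /(_ erefl).
lia.
Qed.

Lemma eqmod_cases a b : a = b %[mod M] -> [\/ a = b, a + M <= b | b + M <= a].
Proof.
move=> ab; have := divn_eq a M; have := divn_eq b M; rewrite ab.
case: (ltngtP (a %/ M) (b %/ M)) => [lt|gt|->] E E'.
- by apply: Or32; have := leq_mul lt (leqnn M); rewrite mulSn; lia.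
- by apply: Or33; have := leq_mul gt (leqnn M); rewrite mulSn; lia.
- by apply: Or31; lia.
Qed.

(** Write u j = v (s j) + k j * M with integers k j.  All values of u, and all
    values of v, lie within less than M of each other, so no k i is positive
    while another k j is negative.  Since the k j sum to 0, they all vanish;
    then s preserves the order because u and v are both decreasing. *)
Lemma narrow_rigid (u v : 'I_l -> nat) (s : 'S_l) :
  0 < M -> narrow u -> narrow v ->
  (forall j, u j = v (s j) %[mod M]) -> \sum_j u j = \sum_j v j ->
  s = 1%g /\ u =1 v.
Proof.
move=> M0 nu nv uv E.
have near w (i j : 'I_l) : narrow w -> w i < w j + M \/ i = j.
  move=> nw; case: (ltngtP i j) => [/nw[]|/nw[]|/val_inj]; [lia|lia|].
  by right.
have Es : \sum_j u j = \sum_j v (s j).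
  by rewrite E (reindex_inj (@perm_inj _ s)).
have spread i j : u i + M <= v (s i) -> v (s j) + M <= u j -> False.
  move=> lt gt; have [uij|e] := near u j i nu; last by subst j; lia.
  by have [vij|/perm_inj e] := near v (s i) (s j) nv; [|subst j]; lia.
have us : u =1 v \o s.
  have [[j lt]|/forallNP le] := pselect (exists j, u j + M <= v (s j)).
    apply: leq_sum_eq => // i /=.
    case: (eqmod_cases (uv i)) => [||gt]; [lia|lia|].
    by case: (spread j i lt gt).
  move=> j; apply/esym; apply: (leq_sum_eq (a := v \o s)) => // i /=.
  by case: (eqmod_cases (uv i)) => [|/le|]; [lia| |lia].
have s1 : s = 1%g.
  apply: perm_mono_id => i j ij; have [+ _] := nu _ _ ij; rewrite !us /=.
  by case: (ltngtP (s i) (s j)) => // [/nv[]|/val_inj ->]; lia.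
by split=> // j; rewrite us s1 /= perm1.
Qed.
End Rigidity.

(** * The cylindric Jacobi-Trudi expression *)

Section Determinant.
Context (l d : nat) (t b : nat -> nat).
Local Open Scope nat_scope.

(** Column j of the shape occupies the rows from [t j] up to, but excluding,
    [b j]; the last two conditions compare the last column with the first one
    shifted by d. *)
Definition cylindric_profile :=
  [/\ forall j, t j.+1 <= t j, forall j, b j.+1 <= b j, forall j, t j <= b j,
      t 0 <= t l.-1 + d & b 0 <= b l.-1 + d].

Definition nboxes := \sum_(j < l) (b j - t j).

(** The quantity t_j - j, up to the constant that makes it a natural number:
    it does not change when a column end moves to the column on the left and
    up by one row, as happens in an exchange. *)
Definition slope (t : nat -> nat) (j : 'I_l) := t j + (l.-1 - j).

Definition drop_height (c : 'I_l) := if c.+1 == l then d else 0.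

Definition top_gap (c : 'I_l) := t c + drop_height c - t (ordS c).

Definition length_vector (s : 'S_l) (m : {ffun 'I_l -> 'I_nboxes.+1}) :=
  (\sum_j m j == nboxes) &&
  [forall j, slope t j + m j == slope b (s j) %[mod l + d]].

(** The sum over k_1 + ... + k_l = 0 of the determinants of
    e_(k_i (l + d) + b_i - t_j - i + j).  The integers k_i are eliminated: they
    are determined by the lengths [m j] of the columns, which satisfy a
    congruence modulo [l + d] and have the size of the shape as their sum. *)
Definition jacobi_trudi (R : comNzRingType) (e : nat -> R) : R :=
  (\sum_(s : 'S_l) \sum_(m | length_vector s m) (-1) ^+ s * \prod_j e (m j))%R.

Definition cyl_columns (disp : Order.disp_t) (P : finPOrderType disp)
    (f : {ffun 'I_l -> nboxes.-bseq P}) :=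
  [&& chains f, flawless top_gap f & [forall j, size (cols f j) == b j - t j]].

Section Expansion.
Context (disp : Order.disp_t) (P : finPOrderType disp).
Context (R : comNzRingType) (w : P -> R).

Definition chain_sum (k : nat) : R :=
  (\sum_(a : k.-tuple P | sorted <%O a) \prod_(p <- a) w p)%R.

Lemma chain_sum_bseq n k : k <= n ->
  chain_sum k =
  (\sum_(A : n.-bseq P | sorted <%O A && (size A == k)) \prod_(p <- A) w p)%R.
Proof.
move=> kn; pose h' (A : n.-bseq P) : option (k.-tuple P) := insub (A : seq P).
rewrite [RHS](reindex_omap (fun a : k.-tuple P => insub_bseq n a) h') /=.
  apply: eq_big => [a|a _]; last by rewrite insub_bseqK // size_tuple.
  rewrite /h' insub_bseqK ?size_tuple // eqxx andbT valK eqxx andbT.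
  by [].
move=> A /andP[_ Ak]; rewrite /h' insubT //=; congr Some; apply/val_inj.
by rewrite /= insub_bseqK // (eqP Ak).
Qed.

Lemma jacobi_trudi_signed :
  (jacobi_trudi chain_sum =
   \sum_(sf : 'S_l * {ffun 'I_l -> nboxes.-bseq P} |
       chains sf.2 && admissible (l + d) (slope t) (slope b) sf.1 sf.2)
      (-1) ^+ sf.1 * weight w sf.2)%R.
Proof.
rewrite -(pair_big_dep xpredT
  (fun s f => chains f && admissible (l + d) (slope t) (slope b) s f)
  (fun s f => (-1) ^+ s * weight w f)%R) /=.
apply: eq_bigr => s _.
pose sizes (f : {ffun 'I_l -> nboxes.-bseq P}) : {ffun 'I_l -> 'I_nboxes.+1} :=
  [ffun j => inord (size (cols f j))].
have sizesE f j : sizes f j = size (cols f j) :> nat.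
  by rewrite ffunE inordK // ltnS size_bseq.
rewrite [RHS](partition_big sizes (length_vector s)) /=; last first.
  move=> f /andP[_ /andP[sf /forallP cf]]; apply/andP; split.
    by under eq_bigr do rewrite sizesE.
  by apply/forallP => j; rewrite sizesE.
apply: eq_bigr => m /andP[sm /forallP cm].
rewrite -mulr_sumr; congr (_ * _)%R.
transitivity (\prod_j \sum_(A : nboxes.-bseq P | sorted <%O A && (size A == m j))
                \prod_(p <- A) w p)%R.
  by apply: eq_bigr => j _; apply: chain_sum_bseq; rewrite -ltnS.
rewrite bigA_distr_big_dep /=; apply: eq_bigl => f.
apply/familyP/idP => [fm|/andP[/andP[/forallP fs _] /eqP <-] j]; last first.
  by apply/andP; split; [exact: fs|rewrite sizesE].
have sz : sizes f = m.
  by apply/ffunP => j; apply/val_inj; rewrite /= sizesE;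
     have /andP[_ /eqP] := fm j.
rewrite sz eqxx andbT; apply/andP; split.
  by apply/forallP => j; have /andP[] := fm j.
rewrite -sz in sm cm; apply/andP; split.
  by move: sm; under eq_bigr do rewrite sizesE.
by apply/forallP => j; rewrite -sizesE.
Qed.

End Expansion.
End Determinant.

(** * Flawless families are cylindric tableaux *)

Lemma val_ordS l (c : 'I_l) : ordS c = (if c.+1 == l then 0 else c.+1)%N :> nat.
Proof.
rewrite /=; case: eqVneq => [->|ne]; first by rewrite modnn.
by rewrite modn_small // ltn_neqAle ne ltn_ord.
Qed.

Section CylindricColumns.
Context (l d : nat) (t b : nat -> nat).
Hypothesis profile : cylindric_profile l d t b.
Local Open Scope nat_scope.

Lemma drop_height_next (v : nat -> nat) (c : 'I_l) :
  (forall j, v j.+1 <= v j) -> v 0 <= v l.-1 + d ->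
  v (ordS c) <= v c + drop_height d c.
Proof.
move=> v_mono v0; rewrite /drop_height val_ordS; case: eqP => [cl|_].
  by rewrite (_ : nat_of_ord c = l.-1) //; lia.
by rewrite addn0.
Qed.

Lemma slope_next (v : nat -> nat) (c : 'I_l) :
  slope v c + v (ordS c) + (if c.+1 == l then l + d else 0) =
  slope v (ordS c) + v c + drop_height d c + 1.
Proof.
have := ltn_ord c; rewrite /slope /drop_height val_ordS.
by case: eqP => [cE|/eqP cE]; lia.
Qed.

Lemma top_gapE (c : 'I_l) :
  t c + drop_height d c = t (ordS c) + top_gap d t c.
Proof.
by case: profile => tm _ _ t0 _; rewrite /top_gap subnKC // drop_height_next.
Qed.

Lemma slope_gap (c : 'I_l) :
  slope t c = slope t (ordS c) + (top_gap d t c).+1 %[mod l + d].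
Proof.
have := slope_next t c; have := top_gapE c; case: eqP => _ E E'.
  by rewrite -[LHS]modnDr; congr modn; lia.
by congr modn; lia.
Qed.

Lemma narrow_slope_b : narrow (l + d) (slope b : 'I_l -> nat).
Proof.
case: profile => _ bm _ _ b0; apply: narrow_step => c.
by have := slope_next b c; have := drop_height_next c bm b0; lia.
Qed.

Section Columns.
Context (disp : Order.disp_t) (P : finPOrderType disp).
Implicit Types f : {ffun 'I_l -> (nboxes l t b).-bseq P}.

(** An entry past the end of its left column would be a flaw, so the ends weakly
    rise from left to right, and the column number makes this strict. *)
Lemma flawless_narrow f : flawless (top_gap d t) f ->
  narrow (l + d) (fun j => slope t j + size (cols f j)).
Proof.
move/eqP/first_flaw_none => nof; apply: narrow_step => c.
have := slope_next t c; have := top_gapE c; have := nof c (size (cols f c)).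
rewrite /flawed /flaw; case Eb: onth => [x|]; first by rewrite onth_default.
have : size (cols f (ordS c)) <= size (cols f c) + top_gap d t c.
  by rewrite -onthNE Eb.
lia.
Qed.

Lemma sum_slope (v : nat -> nat) :
  \sum_(j < l) slope v j = \sum_(j < l) v j + \sum_(j < l) (l.-1 - j).
Proof. by rewrite big_split. Qed.

Lemma flawless_admissible (s : 'S_l) f : flawless (top_gap d t) f ->
  admissible (l + d) (slope t) (slope b) s f ->
  s = 1%g /\ forall j, size (cols f j) = b j - t j.
Proof.
move=> fl /andP[/eqP sf /forallP adm]; case: profile => _ _ tb _ _.
have M0 (j : 'I_l) : 0 < l + d by have := ltn_ord j; lia.
have E : \sum_(j < l) (slope t j + size (cols f j)) = \sum_(j < l) slope b j.
  rewrite big_split /= sf !sum_slope addnAC -big_split /=; congr (_ + _).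
  by apply: eq_bigr => j _; rewrite subnKC.
have [l0|l0] := posnP l.
  by split=> [|j]; [apply/permP => j|]; have := ltn_ord j; lia.
have M0' : 0 < l + d by lia.
have [-> u] := narrow_rigid M0' (flawless_narrow fl) narrow_slope_b
  (fun j => eqP (adm j)) E.
by split=> // j; have := u j; rewrite /slope; lia.
Qed.

Lemma flawless_admissible1 f : (forall j, size (cols f j) = b j - t j) ->
  admissible (l + d) (slope t) (slope b) 1 f.
Proof.
case: profile => _ _ tb _ _ sz; apply/andP; split.
  by apply/eqP/eq_bigr => j _.
apply/forallP => j; rewrite perm1 sz /slope; apply/eqP; congr modn.
by have := tb j; lia.
Qed.

Hypothesis P_free : three_plus_one_free P.

(** The involution leaves the flawless families, and for these
    [flawless_admissible] determines the permutation and the sizes. *)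
Theorem jacobi_trudi_columns (R : comNzRingType) (w : P -> R) :
  (jacobi_trudi l d t b (chain_sum w) =
   \sum_(f : {ffun 'I_l -> (nboxes l t b).-bseq P} | cyl_columns d f)
      weight w f)%R.
Proof.
rewrite jacobi_trudi_signed (sum_flawless P_free _ _ slope_gap) /=.
pose C := {ffun 'I_l -> (nboxes l t b).-bseq P}.
rewrite [RHS](reindex_onto (fun sf : 'S_l * C => sf.2) (fun f => (1%g, f))) //=.
apply: eq_big => [[s f]|[s f]] /=.
  rewrite /cyl_columns; apply/idP/idP.
    case/andP=> /andP[-> adm] fl; have [-> sz] := flawless_admissible fl adm.
    by rewrite fl eqxx andbT; apply/forallP => j; rewrite sz.
  case/andP=> /and3P[-> -> /forallP sz] /eqP[<-].
  by rewrite andbT flawless_admissible1 // => j; exact/eqP.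
case/andP=> /andP[_ adm] fl; have [-> _] := flawless_admissible fl adm.
by rewrite odd_perm1 expr0 mul1r.
Qed.

End Columns.
End CylindricColumns.

(** * Tableaux as families of columns *)

Lemma conj_part_mono lam j : (conj_part lam j.+1 <= conj_part lam j)%N.
Proof. by apply: sub_count => x /=; exact: ltnW. Qed.

Lemma ltn_conj_part lam i j :
  is_partition lam -> (i < conj_part lam j)%N = (j < part lam i)%N.
Proof.
case/andP=> + _; rewrite /conj_part /part (sorted_pairwise) /=; last first.
  by move=> a b c /= ba ac; exact: leq_trans ac ba.
elim: lam i => [|x lam IH] [|i] //=; case/andP=> /allP xlam plam.
  case: (ltnP j x) => // xj; rewrite add0n; apply/negbTE; rewrite -leqNgt leqn0.
  rewrite eqn0Ngt -has_count; apply/hasPn => y /xlam /= yx.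
  by rewrite -leqNgt (leq_trans yx).
rewrite -IH //; case: (ltnP j x) => // xj; rewrite /= add0n.
rewrite (_ : count _ _ = 0%N) //; apply/eqP; rewrite eqn0Ngt -has_count.
by apply/hasPn => y /xlam /= yx; rewrite -leqNgt (leq_trans yx).
Qed.

Section Boxes.
Context (lam mu : seq nat) (d : nat) (shape : cylindric_shape lam mu d).
Local Notation l := (part lam 0).
Local Notation t := (conj_part mu).
Local Notation b := (conj_part lam).
Local Open Scope nat_scope.

Lemma cylindric_profile_conj : cylindric_profile l d t b.
Proof.
case: shape => plam pmu sub /andP[+ _]; rewrite geq_max => /andP[db dt].
split; try exact: conj_part_mono; try lia.
move=> j; rewrite leqNgt; apply/negP; rewrite ltn_conj_part // => lt.
have : b j < b j by rewrite ltn_conj_part // (leq_trans lt).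
by rewrite ltnn.
Qed.

Lemma box_conj i j :
  (part mu i <= j < part lam i) = (t j <= i < b j).
Proof.
case: shape => plam pmu _ _.
by rewrite [t j <= i]leqNgt !ltn_conj_part // -leqNgt.
Qed.

Lemma conj_part_size j : b j <= size lam. Proof. exact: count_size. Qed.

Section Filling.
Context (disp : Order.disp_t) (P : finPOrderType disp).
Implicit Types T : {ffun box lam mu -> P}.

Lemma filling_box T (x : box lam mu) :
  filling T (val x).1 (val x).2 = Some (T x).
Proof.
rewrite /filling; case: pickP => [y /andP[/eqP e1 /eqP e2]|/(_ x)]; last first.
  by rewrite !eqxx.
congr (Some (T _)); apply/val_inj.
rewrite [LHS]surjective_pairing [RHS]surjective_pairing.
by congr (_, _); exact: ord_inj.
Qed.

Lemma box_exists i j : j < l -> t j <= i < b j ->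
  exists x : box lam mu, (val x).1 = i :> nat /\ (val x).2 = j :> nat.
Proof.
move=> jl ij; have il : i < size lam.
  by case/andP: ij => _ ib; exact: leq_trans ib (conj_part_size j).
have cond : part mu (Ordinal il, Ordinal jl).1 <= (Ordinal il, Ordinal jl).2
    < part lam (Ordinal il, Ordinal jl).1 by rewrite /= box_conj.
by exists (exist _ (Ordinal il, Ordinal jl) cond).
Qed.

Lemma filling_some T i j : j < l -> t j <= i < b j ->
  exists p, filling T i j = Some p.
Proof.
move=> jl ij; have [x [<- <-]] := box_exists jl ij.
by exists (T x); exact: filling_box.
Qed.

Lemma filling_dom T i j p : filling T i j = Some p -> j < l /\ t j <= i < b j.
Proof.
rewrite /filling; case: pickP => //= -[[i' j'] /= c] /andP[/eqP <- /eqP <-] _.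
by rewrite ltn_ord -box_conj.
Qed.

Lemma filling_none T i j : ~~ (t j <= i < b j) -> filling T i j = None.
Proof.
by case E: filling => [p|] // /negP[]; have [] := filling_dom E.
Qed.

Definition column_seq T j : seq P :=
  pmap (fun i => filling T i j) (index_iota (t j) (b j)).

Lemma onth_pmap_some (S S' : Type) (h : S -> option S') (s : seq S) k :
  all h s -> onth (pmap h s) k = obind h (onth s k).
Proof.
elim: s k => [|x s IH] k /=; first by rewrite !onth0n.
by case Ex: (h x) => [y|] //= hs; case: k => [|k] //=; exact: IH.
Qed.

Lemma column_all T j : j < l ->
  all (fun i => filling T i j) (index_iota (t j) (b j)).
Proof.
move=> jl; apply/allP => i; rewrite mem_index_iota => ij.
by have [p ->] := filling_some T jl ij.
Qed.

Lemma size_column_seq T j : j < l -> size (column_seq T j) = b j - t j.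
Proof.
move=> jl; rewrite size_pmap -[RHS](size_iota (t j)); apply/eqP.
by rewrite -all_count; exact: column_all.
Qed.

Lemma onth_column_seq T j k : j < l ->
  onth (column_seq T j) k = filling T (t j + k) j.
Proof.
move=> jl; rewrite onth_pmap_some ?column_all //.
have [kb|bk] := ltnP k (b j - t j).
  have -> : onth (index_iota (t j) (b j)) k = Some (t j + k).
    have /onth_some[x Ex] : k < size (index_iota (t j) (b j)).
      by rewrite size_iota.
    by rewrite Ex; congr Some; rewrite -(onth_nth 0 _ _ _ Ex) nth_iota.
  by [].
rewrite onth_default ?size_iota // filling_none //; lia.
Qed.

Definition columns_of T : {ffun 'I_l -> (nboxes l t b).-bseq P} :=
  [ffun j : 'I_l => insub_bseq (nboxes l t b) (column_seq T j)].

Lemma cols_columns_of T (j : 'I_l) : cols (columns_of T) j = column_seq T j.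
Proof.
rewrite /cols ffunE insub_bseqK // size_column_seq // /nboxes (bigD1 j) //=.
exact: leq_addr.
Qed.

Lemma onth_columns_of T (j : 'I_l) k :
  onth (cols (columns_of T) j) k = filling T (t j + k) j.
Proof. by rewrite cols_columns_of onth_column_seq. Qed.

Lemma columns_of_inj : injective columns_of.
Proof.
move=> T T' E; apply/ffunP => x; suff: Some (T x) = Some (T' x) by case.
have /andP[tx _] : t (val x).2 <= (val x).1 < b (val x).2.
  by rewrite -box_conj; exact: (valP x).
by rewrite -!filling_box -(subnKC tx) -!onth_columns_of E.
Qed.

(** The entries are chosen box by box, since P may be empty and then offers no
    default value. *)
Lemma columns_of_surj (f : {ffun 'I_l -> (nboxes l t b).-bseq P}) :
  (forall j, size (cols f j) = b j - t j) -> exists T, columns_of T = f.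
Proof.
move=> sz; have ex (x : box lam mu) :
    exists p, onth (cols f (val x).2) ((val x).1 - t (val x).2) = Some p.
  have ij : t (val x).2 <= (val x).1 < b (val x).2.
    by rewrite -box_conj; exact: (valP x).
  by apply: onth_some; rewrite sz; lia.
have [g gE] := fin_all_exists ex; exists [ffun x => g x].
apply/ffunP => j; apply/val_inj; rewrite -!/(cols _ _).
apply: eq_from_onth => k; rewrite onth_columns_of.
have [kb|bk] := ltnP k (b j - t j); last first.
  by rewrite filling_none ?onth_default ?sz //; lia.
have [|x [x1 x2]] := @box_exists (t j + k) j (ltn_ord j); first by lia.
rewrite -{1}x1 -x2 filling_box ffunE -gE x1 (ord_inj x2).
by rewrite addKn.
Qed.

Lemma weight_columns_of (R : comNzRingType) (w : P -> R) T :
  weight w (columns_of T) = (\prod_x w (T x))%R.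
Proof.
pose G (p : 'I_(size lam) * 'I_l) := oapp w 1%R (filling T p.1 p.2).
transitivity (\prod_p G p)%R.
  rewrite -(pair_big xpredT xpredT (fun i j => G (i, j))) exchange_big /=.
  apply: eq_bigr => j _; rewrite cols_columns_of big_pmap.
  rewrite -(big_mkord xpredT (fun i => oapp w 1%R (filling T i j))).
  have tb : t j <= b j by case: cylindric_profile_conj.
  rewrite [RHS](@big_cat_nat _ _ _ (t j)) ?(leq_trans tb (conj_part_size j)) //=.
  rewrite [X in (_ = _ * X)%R](@big_cat_nat _ _ _ (b j)) ?conj_part_size //=.
  rewrite [X in (_ = X * _)%R]big_nat_cond [X in (_ = X * _)%R]big1 ?mul1r; last first.
    by move=> i /andP[it _]; rewrite filling_none //; lia.
  rewrite [X in (_ = _ * X)%R]big_nat_cond [X in (_ = _ * X)%R]big1 ?mulr1 //.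
  by move=> i /andP[it _]; rewrite filling_none //; lia.
pose cond (p : 'I_(size lam) * 'I_l) := part mu p.1 <= p.2 < part lam p.1.
rewrite (bigID cond) /= [X in (_ * X)%R]big1 ?mulr1; last first.
  by move=> p; rewrite /cond box_conj => /filling_none Fp; rewrite /G Fp.
rewrite (reindex_omap (fun x : box lam mu => val x) insub) /=; last first.
  by move=> p cp; rewrite insubT.
apply: eq_big => [x|x _]; last by have Fx := filling_box T x; rewrite /G Fx.
have cx : cond (val x) := valP x.
by rewrite cx /=; apply/eqP; exact: valK.
Qed.

End Filling.
End Boxes.

Section CylindricTableaux.
Context (lam mu : seq nat) (d : nat) (shape : cylindric_shape lam mu d).
Local Notation l := (part lam 0).
Local Notation t := (conj_part mu).
Local Notation b := (conj_part lam).
Context (disp : Order.disp_t) (P : finPOrderType disp).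
Implicit Types T : {ffun box lam mu -> P}.
Local Open Scope nat_scope.

(** Gluing only matters for the pair formed by the last and the first column,
    where the shift by d appears as [drop_height]. *)
Lemma glue_PtableauP T : is_Ptableau (glue l d (filling T)) <->
  (forall (c : 'I_l) i x y, filling T i c = Some x ->
     filling T i.+1 c = Some y -> (x < y)%O) /\
  (forall (c : 'I_l) i x y, filling T i c = Some x ->
     filling T (i + drop_height d c) (ordS c) = Some y -> ~ (y < x)%O).
Proof.
have glue_in c i : c < l -> glue l d (filling T) (i + d) c = filling T i c.
  by move=> cl; rewrite /glue cl leq_addl addnK.
have glue_out r : glue l d (filling T) r l = filling T r 0.
  by rewrite /glue ltnn eqxx.
split=> [[cT rT]|[cT rT]].
  split=> c i x y Fx Fy.
    by apply: (cT (i + d) c); rewrite -?addSn glue_in.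
  apply: (rT (i + d) c _ _ (etrans (glue_in c i (ltn_ord c)) Fx)).
  move: Fy; rewrite /drop_height val_ordS; case: eqP => [->|cl].
    by rewrite glue_out.
  by rewrite addn0 glue_in // ltn_neqAle ltn_ord andbT; apply/eqP.
have glue_cases r c x : glue l d (filling T) r c = Some x ->
    (exists2 i, r = i + d & c < l /\ filling T i c = Some x) \/
    c = l /\ filling T r 0 = Some x.
  rewrite /glue; case: ltnP => cl; last by case: eqP => // ->; right.
  by case: leqP => // dr Fx; left; exists (r - d); rewrite ?subnK.
split=> r c x y /glue_cases[[i -> [cl Fx]]|[-> Fx]].
- rewrite -addSn glue_in // => Fy.
  exact: (cT (Ordinal cl) _ _ _ Fx Fy).
- rewrite glue_out => Fy; have [l0 _] := filling_dom shape Fx.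
  exact: (cT (Ordinal l0) _ _ _ Fx Fy).
- move=> Fy; apply: (rT (Ordinal cl) _ _ _ Fx).
  rewrite val_ordS /drop_height /=; move: Fy; case: eqP => [->|/eqP cl1].
    by rewrite glue_out.
  by rewrite glue_in ?addn0 // ltn_neqAle cl1.
- by rewrite /glue ltnNge leqnSn /= eqn_leq ltnn.
Qed.

Lemma flawlessP (f : {ffun 'I_l -> (nboxes l t b).-bseq P}) gap :
  reflect (forall c i, ~~ flawed (@ordS l) gap (cols f) c i) (flawless gap f).
Proof.
apply: (iffP eqP) => [/first_flaw_none//|nof].
case E: first_flaw => [x|] //; have [fx _] := first_flaw_least E.
by case/negP: (nof x.1 x.2).
Qed.

(** For columns of the prescribed sizes the left neighbour of an entry can be
    missing only above the left column, by the condition on d; so flaws are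
    exactly the violations of the row condition. *)
Lemma cyl_columns_of T : cyl_columns d (columns_of T) = (T \in CT P lam mu d).
Proof.
have pr := cylindric_profile_conj shape.
rewrite inE; apply/idP/asboolP.
  case/and3P=> /forallP ch /flawlessP nof _; apply/glue_PtableauP; split.
    move=> c i x y Fx Fy; have [_ /andP[ti _]] := filling_dom shape Fx.
    apply: (sorted_lt (ch c) (ltnSn (i - t c)));
      by rewrite (onth_columns_of shape) ?addnS subnKC.
  move=> c i x y Fx Fy yx; have [_ /andP[ti _]] := filling_dom shape Fx.
  have := nof c (i - t c); rewrite /flawed /flaw !(onth_columns_of shape).
  rewrite subnKC // Fx (_ : t (ordS c) + _ = i + drop_height d c) ?Fy ?yx //.
  by have := top_gapE pr c; lia.
move/glue_PtableauP=> [cT rT]; apply/and3P; split.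
- apply/forallP => c; apply/sorted_onth_stepP => i x y.
  by rewrite !(onth_columns_of shape) addnS; exact: cT.
- apply/flawlessP => c i; rewrite /flawed /flaw !(onth_columns_of shape).
  rewrite (_ : t (ordS c) + _ = t c + i + drop_height d c); last first.
    by have := top_gapE pr c; lia.
  case Fy: (filling T _ (ordS c)) => [y|] //.
  case Fx: filling => [x|]; first by apply/negP; exact: rT Fx Fy.
  have [_ /andP[_ yb]] := filling_dom shape Fy.
  case: pr => _ bm _ _ b0; have := drop_height_next c bm b0 => bc.
  have [|x] := @filling_some _ _ _ shape _ _ T (t c + i) c (ltn_ord c).
    by lia.
  by rewrite Fx.
- by apply/forallP => c; rewrite (cols_columns_of shape) (size_column_seq shape).
Qed.

Theorem jacobi_trudi_tableaux (R : comNzRingType) (w : P -> R) :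
  three_plus_one_free P ->
  (jacobi_trudi l d t b (chain_sum w) =
   \sum_(T in CT P lam mu d) \prod_x w (T x))%R.
Proof.
move=> P_free; rewrite jacobi_trudi_columns //; last first.
  exact: cylindric_profile_conj shape.
rewrite (reindex_omap (@columns_of lam mu disp P)
           (fun f => [pick T | columns_of T == f])) /=; last first.
  move=> f /and3P[_ _ /forallP sz].
  have [T TE] : exists T : {ffun box lam mu -> P}, columns_of T = f.
    by apply: columns_of_surj shape _ _ _ _ => j; exact/eqP.
  by case: pickP => [T' /eqP T'E|/(_ T)] /=; [rewrite T'E|rewrite TE eqxx].
apply: eq_big => [T|T _]; last exact: (weight_columns_of shape).
rewrite cyl_columns_of andbC; case: pickP => [T' /eqP TT|/(_ T)].
  by rewrite (columns_of_inj shape TT) eqxx.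
by rewrite eqxx.
Qed.

End CylindricTableaux.

Lemma jacobi_trudi_morph l d t b (R S : comNzRingType)
    (phi : {rmorphism R -> S}) (e : nat -> R) :
  phi (jacobi_trudi l d t b e) = jacobi_trudi l d t b (phi \o e).
Proof.
rewrite rmorph_sum; apply: eq_bigr => s _; rewrite rmorph_sum.
by apply: eq_bigr => m _; rewrite rmorphM rmorph_sign rmorph_prod.
Qed.

(** * Symmetric functions *)

Section Truncation.
Context (n : nat).

Definition trunc_at (f : Lambda) : {mpoly int[n]} := f n.

Lemma trunc_at_is_zmod_morphism : zmod_morphism trunc_at.
Proof. by []. Qed.

Lemma trunc_at_is_monoid_morphism : monoid_morphism trunc_at.
Proof. by []. Qed.

HB.instance Definition _ := GRing.isZmodMorphism.Build
  Lambda {mpoly int[n]} trunc_at trunc_at_is_zmod_morphism.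
HB.instance Definition _ := GRing.isMonoidMorphism.Build
  Lambda {mpoly int[n]} trunc_at trunc_at_is_monoid_morphism.

End Truncation.

Lemma ord_three_plus_one_free n : three_plus_one_free 'I_n.
Proof.
by case=> a [b [c [x [_ _ /negP xa _ _]]]]; case: xa; exact: le_total.
Qed.

Lemma chain_sum_mesym n k :
  chain_sum (fun i : 'I_n => 'X_i : {mpoly int[n]}) k = mesym n int k.
Proof.
rewrite mesym_tupleE; apply: eq_bigl => a.
by rewrite /tmono sorted_map.
Qed.

Lemma cyl_schur_truncE lam mu d n : cylindric_shape lam mu d ->
  cyl_schur_trunc lam mu d n =
  jacobi_trudi (part lam 0) d (conj_part mu) (conj_part lam) elem n.
Proof.
move=> shape; rewrite -[RHS]/(trunc_at n _) jacobi_trudi_morph /cyl_schur_trunc.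
rewrite -(jacobi_trudi_tableaux shape (fun i : 'I_n => 'X_i)); last first.
  exact: ord_three_plus_one_free.
by congr jacobi_trudi; apply/funext => k; exact: chain_sum_mesym.
Qed.

(** The truncations agree with those of an element of Lambda, so they do form a
    symmetric function, which is what selects the first branch of [cyl_schur]. *)
Lemma cyl_schurE lam mu d : cylindric_shape lam mu d ->
  cyl_schur lam mu d =
  jacobi_trudi (part lam 0) d (conj_part mu) (conj_part lam) elem.
Proof.
move=> shape; set J := jacobi_trudi _ _ _ _ _.
have E : cyl_schur_trunc lam mu d = trunc J.
  by apply: functional_extensionality_dep => n; exact: cyl_schur_truncE.
rewrite /cyl_schur; case: pselect => [sym|[]].
  by apply: Lambda_eq => n; rewrite /= E.
by rewrite E; exact: truncP.
Qed.

Theorem theorem2p6 (disp : Order.disp_t) (P : finPOrderType disp)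
    (lam mu : seq nat) (d : nat)
    (P_free : three_plus_one_free P) (shape : cylindric_shape lam mu d) :
  cyl_schurP P lam mu d = (\sum_(T in CT P lam mu d) u_tab T)%R.
Proof.
rewrite /cyl_schurP cyl_schurE // jacobi_trudi_morph.
rewrite -(jacobi_trudi_tableaux shape (@u _ P)) //.
by congr jacobi_trudi; apply/funext => k; exact: psi_elem.
Qed.
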